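(* Let $\mathbf{k}$ be an algebraically closed field, let $R=\mathbf{k}[\![x_1,\dots,x_n]\!]$, and let $A=R/I$ be an Artin ring of Gorenstein colength $t$. Then there exists a quasi-projective sub-variety $MGC^n(A)$ ($n=\dim R$) of the projective space $\mathbb{P}_{\mathbf{k}}(\mathcal{L}_{A,t})$ whose set of closed points consists of the points $[\overline{F}]$, $\overline{F}\in\mathcal{L}_{A,t}$ (with $F\in\int_{\mathfrak m^t}I^\perp$ a representative of $\overline{F}$), such that $G=R/\mathrm{Ann}_R F$ is a minimal Gorenstein cover of $A$.
   Context: $\mathfrak m$ is the maximal ideal of $R=\mathbf{k}[\![x_1,\dots,x_n]\!]$ and $S=\mathbf{k}[y_1,\dots,y_n]$ is an $R$-module by contraction: $x^\alpha\circ y^\beta=y^{\beta-\alpha}$ if $\beta\ge\alpha$ componentwise and $0$ otherwise. For an ideal $I$ of $R$, $I^\perp=\{G\in S: I\circ G=0\}$; for $F\in S$, $\langle F\rangle=R\circ F$ is the $R$-submodule generated by $F$ and $\mathrm{Ann}_R F=\{f\in R: f\circ F=0\}$. For an ideal $K$ of $R$ and an $R$-submodule $M$ of $S$, $\int_K M=\{G\in S: K\circ G\subset M\}$. $\ell$ denotes length. For $A=R/I$ Artin, $G=R/\mathrm{Ann}_R F$ is a Gorenstein cover of $A$ if $I^\perp\subset\langle F\rangle$. The Gorenstein colength is $\mathrm{gcl}(A)=\min\{\ell(G)-\ell(A): G \text{ a Gorenstein cover of } A\}$, and a Gorenstein cover $G$ is minimal if $\ell(G)=\ell(A)+\mathrm{gcl}(A)$.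 $\mathcal{L}_{A,t}$ is the finite-dimensional quotient $\int_{\mathfrak m^t}I^\perp/I^\perp$, and $\mathbb{P}_{\mathbf{k}}(\mathcal{L}_{A,t})$ is the projective space of lines through $0$ in it; $[\overline F]$ is the point given by a nonzero class $\overline F$. Quasi-projective sub-variety means Zariski locally closed subset. *)

(* Defs.v *)
From HB Require Import structures.
From mathcomp Require Import all_boot all_order all_algebra.
From mathcomp Require Import ring_quotient boolp classical_sets ssrcomplements mpoly.

Set Implicit Arguments.
Unset Strict Implicit.
Unset Printing Implicit Defensive.

Import GRing.Theory.
Local Open Scope ring_scope.
Local Open Scope quotient_scope.

Record submodule (R : pzRingType) (V : lmodType R) := Submodule {
  submod_pred :> {pred V};
  submod_closedP : submod_closed submod_pred }.

HB.instance Definition _ (R : pzRingType) (V : lmodType R) (W : submodule V) :=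
  GRing.isSubmodClosed.Build R V (submod_pred W)
    (GRing.submod_closed_semi (submod_closedP W)).

Definition ideal (R : comPzRingType) := submodule R^o.

Section SubmoduleType.
Variables (R : pzRingType) (V : lmodType R) (W : submodule V).

Record submod_type := SubmodType {
  submod_val : V;
  submod_valP : submod_val \in W }.

HB.instance Definition _ := [isSub for submod_val].
HB.instance Definition _ := [Choice of submod_type by <:].
HB.instance Definition _ := [SubChoice_isSubLmodule of submod_type by <:].

End SubmoduleType.

Section QuotientModule.
Variables (R : pzRingType) (V : lmodType R) (W : submodule V).

Definition quotmod := Quotient.quot (submod_pred W).

HB.instance Definition _ := GRing.Zmodule.on quotmod.

Definition quotmod_pi (v : V) : quotmod := \pi v.

Definition quotmod_scale (a : R) (x : quotmod) : quotmod :=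
  quotmod_pi (a *: repr x).

Lemma quotmod_piP v w : reflect (quotmod_pi v = quotmod_pi w) (v - w \in W).
Proof.
rewrite Quotient.idealrBE; exact: (iffP eqP).
Qed.

Lemma quotmod_reprK x : quotmod_pi (repr x) = x.
Proof. exact: reprK. Qed.

Lemma quotmod_piD v w : quotmod_pi (v + w) = quotmod_pi v + quotmod_pi w.
Proof. exact: (raddfD (\pi_(Quotient.quot (submod_pred W)))). Qed.

Lemma quotmod_scaleE a v : quotmod_scale a (quotmod_pi v) = quotmod_pi (a *: v).
Proof.
apply/quotmod_piP; rewrite -scalerBr rpredZ //.
by apply/quotmod_piP; rewrite quotmod_reprK.
Qed.

Fact quotmod_scaleA a b x :
  quotmod_scale a (quotmod_scale b x) = quotmod_scale (a * b) x.
Proof. by rewrite -[x]quotmod_reprK !quotmod_scaleE scalerA. Qed.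

Fact quotmod_scale1 : left_id 1 quotmod_scale.
Proof. by move=> x; rewrite -[x]quotmod_reprK quotmod_scaleE scale1r. Qed.

Fact quotmod_scaleDr : right_distributive quotmod_scale +%R.
Proof.
move=> a x y; rewrite -[x]quotmod_reprK -[y]quotmod_reprK.
by rewrite -quotmod_piD !quotmod_scaleE scalerDr quotmod_piD.
Qed.

Fact quotmod_scaleDl x : {morph quotmod_scale^~ x : a b / a + b}.
Proof.
move=> a b; rewrite -[x]quotmod_reprK !quotmod_scaleE.
by rewrite scalerDl quotmod_piD.
Qed.

HB.instance Definition _ := GRing.Zmodule_isLmodule.Build R quotmod
  quotmod_scaleA quotmod_scale1 quotmod_scaleDr quotmod_scaleDl.

End QuotientModule.

(* Unlike [{ideal_quot I}], this allows I to be the unit ideal. *)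
Section QuotientRing.
Variables (R : comPzRingType) (I : ideal R).

Definition quotring := Quotient.quot (submod_pred I).

HB.instance Definition _ := GRing.Zmodule.on quotring.

Definition quotring_pi (a : R) : quotring := \pi a.

Definition quotring_mul (x y : quotring) : quotring :=
  quotring_pi (repr x * repr y).

Lemma quotring_piP a b : reflect (quotring_pi a = quotring_pi b) (a - b \in I).
Proof. exact: (@quotmod_piP R R^o I). Qed.

Lemma quotring_reprK x : quotring_pi (repr x) = x.
Proof. exact: reprK. Qed.

Lemma quotring_piD a b : quotring_pi (a + b) = quotring_pi a + quotring_pi b.
Proof. exact: (@quotmod_piD R R^o I). Qed.

Lemma quotring_mulE a b :
  quotring_mul (quotring_pi a) (quotring_pi b) = quotring_pi (a * b).
Proof.
apply/quotring_piP; set a' := repr _; set b' := repr _.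
have aI : a' - a \in I by apply/quotring_piP; rewrite quotring_reprK.
have bI : b' - b \in I by apply/quotring_piP; rewrite quotring_reprK.
have abI : (a' : R) *: (b' - b : R^o) + (b : R) *: (a' - a : R^o) \in I.
  by rewrite rpredD // rpredZ.
have -> : a' * b' - a * b = a' * (b' - b) + b * (a' - a); last exact: abI.
by rewrite !mulrBr addrA (mulrC b a') (mulrC b a) addrNK.
Qed.

Fact quotring_mulA : associative quotring_mul.
Proof.
move=> x y z; rewrite -[x]quotring_reprK -[y]quotring_reprK -[z]quotring_reprK.
by rewrite !quotring_mulE mulrA.
Qed.

Fact quotring_mulC : commutative quotring_mul.
Proof.
move=> x y; rewrite -[x]quotring_reprK -[y]quotring_reprK.
by rewrite !quotring_mulE mulrC.
Qed.

Fact quotring_mul1 : left_id (quotring_pi 1) quotring_mul.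
Proof. by move=> x; rewrite -[x]quotring_reprK quotring_mulE mul1r. Qed.

Fact quotring_mulDl : left_distributive quotring_mul +%R.
Proof.
move=> x y z; rewrite -[x]quotring_reprK -[y]quotring_reprK -[z]quotring_reprK.
by rewrite -quotring_piD !quotring_mulE mulrDl quotring_piD.
Qed.

HB.instance Definition _ := GRing.Zmodule_isComPzRing.Build quotring
  quotring_mulA quotring_mulC quotring_mul1 quotring_mulDl.

End QuotientRing.

Definition artinian (A : comPzRingType) : Prop :=
  forall J : nat -> ideal A,
    (forall i, {subset J i.+1 <= J i}) ->
    exists N, forall i, (N <= i)%N -> J i =i J N.

Definition strict_chain (R : pzRingType) (V : lmodType R)
    (W : nat -> submodule V) (l : nat) : Prop :=
  forall i, (i < l)%N ->
    {subset W i <= W i.+1} /\ ~ {subset W i.+1 <= W i}.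

(* The maximal length of a strict chain is l; fails for every l if V has
   infinite length. *)
Definition has_length (R : pzRingType) (V : lmodType R) (l : nat) : Prop :=
  (exists W : nat -> submodule V, strict_chain W l) /\
  (forall (W : nat -> submodule V) l', strict_chain W l' -> (l' <= l)%N).

Definition has_ring_length (A : comPzRingType) (l : nat) : Prop :=
  has_length A^o l.

Section IdealOps.
Variable R : comPzRingType.

Definition ideal_mul_pred (I J : ideal R) : {pred R^o} :=
  [pred x | `[< exists s : seq (R * R),
     all (fun p => (p.1 \in I) && (p.2 \in J)) s /\
     x = \sum_(p <- s) p.1 * p.2 >] ].

Fact ideal_mul_closed I J : submod_closed (ideal_mul_pred I J).
Proof.
split=> [|a x y]; first by apply/asboolP; exists [::]; rewrite big_nil.
move=> /asboolP [s [sIJ ->]] /asboolP [u [uIJ ->]]; apply/asboolP.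
exists ([seq (a * p.1, p.2) | p <- s] ++ u); rewrite all_cat uIJ andbT; split.
  rewrite all_map; apply: sub_all sIJ => p /= /andP [pI ->].
  by rewrite andbT; apply: (rpredZ a).
rewrite big_cat big_map; congr (_ + _); rewrite /GRing.scale /= mulr_sumr.
by apply: eq_bigr => p _; rewrite mulrA.
Qed.

Definition ideal_mul I J : ideal R := Submodule (ideal_mul_closed I J).

Fact unit_ideal_closed : submod_closed (predT : {pred R^o}).
Proof. by []. Qed.

Definition unit_ideal : ideal R := Submodule unit_ideal_closed.

Definition ideal_exp (I : ideal R) (t : nat) : ideal R :=
  iter t (ideal_mul I) unit_ideal.

End IdealOps.

Section SumBelow.
Variables (n : nat) (K : nmodType).

Lemma sum_shift (d d' : nat) (c e : 'X_{1..n}) (F : 'X_{1..n} -> K) :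
  (mdeg e < d)%N -> (mdeg e < d')%N -> (c <= e)%MM ->
  \sum_(b : 'X_{1..n < d} | (c <= b)%MM && (b <= e)%MM) F b =
  \sum_(a : 'X_{1..n < d'} | (a <= e - c)%MM) F (a + c)%MM.
Proof.
case: d d' => [|d] [|d'] // ed ed' ce.
have le_mdeg (a b : 'X_{1..n}) : (a <= b)%MM -> (mdeg a <= mdeg b)%N.
  by move=> ab; rewrite -(submK ab) mdegD leq_addl.
pose h (a : 'X_{1..n < d'.+1}) : 'X_{1..n < d.+1} := insubd bm0 (a + c)%MM.
pose h' (b : 'X_{1..n < d.+1}) : 'X_{1..n < d'.+1} := insubd bm0 (b - c)%MM.
have hE (a : 'X_{1..n < d'.+1}) : (a + c <= e)%MM -> h a = (a + c)%MM :> 'X_{1..n}.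
  by move=> ae; rewrite val_insubd (leq_ltn_trans (le_mdeg _ _ ae)).
have h'E (b : 'X_{1..n < d.+1}) : (b <= e)%MM -> h' b = (b - c)%MM :> 'X_{1..n}.
  move=> be; rewrite val_insubd.
  by rewrite (leq_ltn_trans (mdegB _ _)) // (leq_ltn_trans (le_mdeg _ _ be)).
have subP (a : 'X_{1..n}) : (a <= e - c)%MM = (a + c <= e)%MM.
  have sub_i i : (a i <= (e - c)%MM i)%N = ((a + c)%MM i <= e i)%N.
    by rewrite mnmBE mnmDE leq_subRL 1?addnC //; apply: (mnm_lepP ce).
  by apply/mnm_lepP/mnm_lepP => H i; move: (H i); rewrite sub_i.
have hP (a : 'X_{1..n < d'.+1}) : [&& (c <= h a)%MM, (h a <= e)%MM & h' (h a) == a] ->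
    h a = (a + c)%MM :> 'X_{1..n}.
  by case/and3P=> cb be /eqP ha; rewrite -{2}ha h'E // submK.
rewrite (reindex_onto h h') /=; last first.
  by move=> b /andP [cb be]; apply/val_inj; rewrite /= hE h'E ?submK.
apply: eq_big => [a|a]; last by rewrite -andbA => /hP ->.
rewrite subP -andbA; apply/idP/idP => [H|ae].
  by rewrite -(hP a H); case/and3P: H.
apply/and3P; split; rewrite ?hE ?lem_addl //.
by apply/eqP/val_inj; rewrite /= h'E hE ?addmK.
Qed.

End SumBelow.

Section PowerSeries.
Variables (n : nat) (K : comNzRingType).

Record mseries := MSeries { mscoef : 'X_{1..n} -> K }.

Implicit Types f g h : mseries.
Implicit Types m : 'X_{1..n}.

HB.instance Definition _ := gen_eqMixin mseries.
HB.instance Definition _ := gen_choiceMixin mseries.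

Lemma mseriesP f g : (forall m, mscoef f m = mscoef g m) -> f = g.
Proof.
by case: f g => [f] [g] /= fg; congr MSeries; apply/funext.
Qed.

Definition mseries_zero := MSeries (fun=> 0).
Definition mseries_opp f := MSeries (fun m => - mscoef f m).
Definition mseries_add f g := MSeries (fun m => mscoef f m + mscoef g m).

Fact mseries_addA : associative mseries_add.
Proof. by move=> f g h; apply: mseriesP => m; apply: addrA. Qed.

Fact mseries_addC : commutative mseries_add.
Proof. by move=> f g; apply: mseriesP => m; apply: addrC. Qed.

Fact mseries_add0 : left_id mseries_zero mseries_add.
Proof. by move=> f; apply: mseriesP => m; apply: add0r. Qed.

Fact mseries_addN : left_inverse mseries_zero mseries_opp mseries_add.
Proof. by move=> f; apply: mseriesP => m; apply: addNr. Qed.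

HB.instance Definition _ := GRing.isZmodule.Build mseries
  mseries_addA mseries_addC mseries_add0 mseries_addN.

(* The bound on the index type only makes the sum finite: every a <= m
   satisfies mdeg a < (mdeg m).+1. *)
Definition mseries_mul f g := MSeries (fun m =>
  \sum_(a : 'X_{1..n < (mdeg m).+1} | (a <= m)%MM)
     mscoef f a * mscoef g (m - a)%MM).

Definition mseriesC (c : K) :=
  MSeries (fun m => if m == 0%MM then c else 0).

Definition mtrunc (d : nat) f : {mpoly K[n]} :=
  \sum_(a : 'X_{1..n < d}) mscoef f a *: 'X_[a].

Lemma mcoeff_mtrunc d f m : (mdeg m < d)%N -> (mtrunc d f)@_m = mscoef f m.
Proof.
move=> md; rewrite /mtrunc raddf_sum /= (bigD1 (BMultinom md)) //=.
rewrite mcoeffZ mcoeffX eqxx mulr1 big1 ?addr0 // => a /negbTE am.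
by rewrite mcoeffZ mcoeffX -(bmeqP a (BMultinom md)) am mulr0.
Qed.

Lemma mdeg_le (a b : 'X_{1..n}) : (a <= b)%MM -> (mdeg a <= mdeg b)%N.
Proof. by move=> ab; rewrite -(submK ab) mdegD leq_addl. Qed.

Lemma mcoeffM_lin (p q : {mpoly K[n]}) m :
  (p * q)@_m = \sum_(a : 'X_{1..n < (mdeg m).+1} | (a <= m)%MM)
                 p@_a * q@_(m - a)%MM.
Proof. exact: mcoeff_poly_mul_lin. Qed.

Lemma mscoef_mul d f g m : (mdeg m < d)%N ->
  mscoef (mseries_mul f g) m = (mtrunc d f * mtrunc d g)@_m.
Proof.
move=> md; rewrite mcoeffM_lin /=; apply: eq_bigr => a am.
rewrite !mcoeff_mtrunc // (leq_ltn_trans _ md) ?mdegB //; exact: mdeg_le.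
Qed.

Lemma mcoeffM_eq (p p' q q' : {mpoly K[n]}) m :
    (forall a, (mdeg a <= mdeg m)%N -> p@_a = p'@_a) ->
    (forall a, (mdeg a <= mdeg m)%N -> q@_a = q'@_a) ->
  (p * q)@_m = (p' * q')@_m.
Proof.
move=> pp' qq'; rewrite !mcoeffM_lin; apply: eq_bigr => a am.
by rewrite pp' ?mdeg_le // qq' ?mdegB.
Qed.

Lemma mtrunc_mul d f g m : (mdeg m < d)%N ->
  (mtrunc d (mseries_mul f g))@_m = (mtrunc d f * mtrunc d g)@_m.
Proof. by move=> md; rewrite mcoeff_mtrunc // (mscoef_mul _ _ md). Qed.

Fact mseries_mulA : associative mseries_mul.
Proof.
move=> f g h; apply: mseriesP => m.
rewrite !(@mscoef_mul (mdeg m).+1) //.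
set T := mtrunc _; transitivity ((T f * (T g * T h))@_m).
  by apply: mcoeffM_eq => // a am; rewrite mtrunc_mul.
rewrite mulrA; apply: mcoeffM_eq => // a am.
by rewrite mtrunc_mul.
Qed.

Fact mseries_mulC : commutative mseries_mul.
Proof.
by move=> f g; apply: mseriesP => m; rewrite !(@mscoef_mul (mdeg m).+1) // mulrC.
Qed.

Fact mseries_mul1 : left_id (mseriesC 1) mseries_mul.
Proof.
move=> f; apply: mseriesP => m; rewrite (@mscoef_mul (mdeg m).+1) //.
transitivity ((1 * mtrunc (mdeg m).+1 f)@_m); last first.
  by rewrite mul1r mcoeff_mtrunc.
apply: mcoeffM_eq => // a am; rewrite mcoeff_mtrunc //= mcoeff1.
by case: eqP.
Qed.

Fact mseries_mulDl : left_distributive mseries_mul +%R.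
Proof.
move=> f g h; apply: mseriesP => m /=; rewrite -big_split /=.
by apply: eq_bigr => a _; rewrite mulrDl.
Qed.

Fact mseries_one_neq0 : mseriesC 1 != 0.
Proof.
apply/eqP => /(congr1 (fun f => mscoef f 0%MM)) /= /eqP.
by rewrite eqxx oner_eq0.
Qed.

HB.instance Definition _ := GRing.Zmodule_isComNzRing.Build mseries
  mseries_mulA mseries_mulC mseries_mul1 mseries_mulDl mseries_one_neq0.

Lemma mscoef0 m : mscoef 0 m = 0. Proof. by []. Qed.
Lemma mscoefN f m : mscoef (- f) m = - mscoef f m. Proof. by []. Qed.
Lemma mscoefD f g m : mscoef (f + g) m = mscoef f m + mscoef g m.
Proof. by []. Qed.
Lemma mscoef1 m : mscoef 1 m = (m == 0%MM)%:R.
Proof. by rewrite /GRing.one /=; case: eqP. Qed.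

Lemma mscoefM d f g m : (mdeg m < d)%N ->
  mscoef (f * g) m = \sum_(a : 'X_{1..n < d} | (a <= m)%MM)
     mscoef f a * mscoef g (m - a)%MM.
Proof.
move=> md; have le0 : (0%MM <= m)%MM by apply/mnm_lepP => i; rewrite mnmE.
pose F a := mscoef f a * mscoef g (m - a)%MM.
rewrite /GRing.mul /=; transitivity (\sum_(a : 'X_{1..n < d} | (a <= m - 0)%MM) F (a + 0)%MM).
  rewrite -(@sum_shift _ _ (mdeg m).+1 d 0%MM m F) //.
  apply: eq_bigl => a; rewrite [X in _ = X && _](_ : _ = true) //.
  by apply/mnm_lepP => i; rewrite mnmE.
by rewrite subm0; apply: eq_bigr => a _; rewrite addm0.
Qed.

(* The bilinear extension of x^a o y^b = y^(b - a) if a <= b, 0 otherwise. *)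
Definition contract f (G : {mpoly K[n]}) : {mpoly K[n]} :=
  \sum_(b <- msupp G) \sum_(a : 'X_{1..n < (mdeg b).+1} | (a <= b)%MM)
     (mscoef f a * G@_b) *: 'X_[(b - a)%MM].

Lemma contractE d f (G : {mpoly K[n]}) c :
    (forall m, (d <= mdeg m)%N -> G@_m = 0) ->
  (contract f G)@_c =
    \sum_(b : 'X_{1..n < d} | (c <= b)%MM) mscoef f (b - c)%MM * G@_b.
Proof.
move=> Gd; pose H (b : 'X_{1..n}) :=
  if (c <= b)%MM then mscoef f (b - c)%MM * G@_b else 0.
transitivity (\sum_(b <- msupp G) H b).
  rewrite /contract raddf_sum; apply: eq_bigr => b _ /=.
  rewrite raddf_sum /= /H; case: ifPn => [cb|ncb]; last first.
    rewrite big1 // => a ab; rewrite mcoeffZ mcoeffX.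
    case: eqP => [E|_]; last by rewrite mulr0.
    by case/negP: ncb; rewrite -E lem_subr.
  have bcd : (mdeg (b - c)%MM < (mdeg b).+1)%N by rewrite ltnS mdegB.
  rewrite (bigD1 (BMultinom bcd)) /= ?lem_subr //.
  have -> : (b - (b - c) = c)%MM.
    by rewrite -{1}(submK cb) addmC addmK.
  rewrite mcoeffZ mcoeffX eqxx mulr1 big1 ?addr0 // => a /andP [ab ne].
  rewrite mcoeffZ mcoeffX; case: eqP => [E|_]; last by rewrite mulr0.
  case/negP: ne; apply/eqP/val_inj => /=.
  by rewrite -E -{2}(submK ab) addmC addmK.
rewrite (big_mksub ('X_{1..n < d} : subFinType _)) ?msupp_uniq //=; last first.
  move=> m; rewrite mcoeff_msupp ltnNge; apply: contraNN => /Gd ->.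
  by rewrite eqxx.
rewrite big_rmcond /= => [|b]; last first.
  by move/memN_msupp_eq0; rewrite /H => ->; rewrite mulr0 if_same.
by rewrite [RHS]big_mkcond.
Qed.

Lemma msize_out (G : {mpoly K[n]}) m : (msize G <= mdeg m)%N -> G@_m = 0.
Proof. by move=> h; apply/memN_msupp_eq0/msize_mdeg_ge. Qed.

Lemma contract_out d f (G : {mpoly K[n]}) :
    (forall m, (d <= mdeg m)%N -> G@_m = 0) ->
  forall m, (d <= mdeg m)%N -> (contract f G)@_m = 0.
Proof.
move=> Gd m dm; rewrite (contractE _ _ Gd) big1 // => b /mdeg_le mb.
by have := leq_ltn_trans (leq_trans dm mb) (bmdeg b); rewrite ltnn.
Qed.

Lemma contractZDr f (a : K) G H :
  contract f (a *: G + H) = a *: contract f G + contract f H.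
Proof.
apply/mpolyP => c; rewrite mcoeffD mcoeffZ.
pose d := maxn (msize G) (msize H).
have Gd m : (d <= mdeg m)%N -> G@_m = 0.
  by move=> h; apply: msize_out; apply: leq_trans h; apply: leq_maxl.
have Hd m : (d <= mdeg m)%N -> H@_m = 0.
  by move=> h; apply: msize_out; apply: leq_trans h; apply: leq_maxr.
rewrite (contractE _ _ Gd) (contractE _ _ Hd) (@contractE d) => [|m dm].
  rewrite mulr_sumr -big_split /=; apply: eq_bigr => b _.
  by rewrite mcoeffD mcoeffZ mulrDr mulrCA.
by rewrite mcoeffD mcoeffZ Gd // Hd // mulr0 addr0.
Qed.

Lemma contract0r f : contract f 0 = 0.
Proof. by rewrite /contract msupp0 big_nil. Qed.

Lemma contractDl f g G : contract (f + g) G = contract f G + contract g G.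
Proof.
apply/mpolyP => c; rewrite mcoeffD !(@contractE (msize G)) //; try exact: msize_out.
by rewrite -big_split /=; apply: eq_bigr => b _; rewrite mulrDl.
Qed.

Lemma contract0l G : contract 0 G = 0.
Proof.
apply/mpolyP => c; rewrite (@contractE (msize G)) //; last exact: msize_out.
by rewrite mcoeff0 big1 // => b _; rewrite mul0r.
Qed.

Lemma contract1 G : contract 1 G = G.
Proof.
move: mscoef1; move: (1 : mseries) => u u1.
apply/mpolyP => c; pose d := maxn (msize G) (mdeg c).+1.
have Gd m : (d <= mdeg m)%N -> G@_m = 0.
  by move=> h; apply: msize_out; apply: leq_trans h; apply: leq_maxl.
have cd : (mdeg c < d)%N by rewrite leq_maxr.
rewrite (contractE _ _ Gd) (bigD1 (BMultinom cd)) /= ?lepm_refl //.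
have -> : (c - c = 0)%MM by apply/mnmP => i; rewrite mnmBE mnm0E subnn.
rewrite u1 eqxx mul1r big1 ?addr0 // => b /andP [cb ne].
rewrite u1; case: eqP => [E|_]; last by rewrite mul0r.
by case/negP: ne; apply/eqP/val_inj; rewrite /= -(submK cb) E add0m.
Qed.

Lemma contractM f g G : contract (f * g) G = contract f (contract g G).
Proof.
pose d := msize G; have Gd m : (d <= mdeg m)%N -> G@_m = 0 by exact: msize_out.
apply/mpolyP => c; rewrite (contractE _ _ Gd).
rewrite (contractE _ _ (contract_out g Gd)).
transitivity (\sum_(b : 'X_{1..n < d} | (c <= b)%MM)
    \sum_(e : 'X_{1..n < d} | (b <= e)%MM)
      mscoef f (b - c)%MM * mscoef g (e - b)%MM * G@_e); last first.
  apply: eq_bigr => b _; rewrite (contractE _ _ Gd) mulr_sumr.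
  by apply: eq_bigr => e _; rewrite mulrA.
rewrite (exchange_big_dep (fun e : 'X_{1..n < d} => (c <= e)%MM)) /=; last first.
  by move=> b e; apply: lepm_trans.
apply: eq_bigr => e ce; rewrite -mulr_suml; congr (_ * _).
pose F (b : 'X_{1..n}) := mscoef f (b - c)%MM * mscoef g (e - b)%MM.
rewrite (@sum_shift n K d (mdeg e).+1 c e F) ?bmdeg //.
transitivity (mscoef (f * g) (e - c)%MM); first by [].
rewrite (@mscoefM (mdeg e).+1) ?ltnS ?mdegB //.
apply: eq_bigr => a _; rewrite /F addmK; congr (_ * mscoef g _).
by apply/mnmP => i; rewrite !mnmBE mnmDE (addnC (a i)) subnDA.
Qed.

End PowerSeries.

Section MaximalIdeal.
Variables (n : nat) (k : fieldType).

Definition mseries_maxideal_pred : {pred (mseries n k)^o} :=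
  [pred f | mscoef f 0%MM == 0].

Fact mseries_maxideal_closed : submod_closed mseries_maxideal_pred.
Proof.
split=> [|f g h]; rewrite !inE ?mscoef0 // => /eqP g0 /eqP h0.
rewrite mscoefD h0 addr0 (@mscoefM _ _ 1) ?mdeg0 //.
rewrite big1 // => a a0; suff -> : bmnm a = 0%MM by rewrite subm0 g0 mulr0.
apply/mnmP => i; apply/eqP; have := mnm_lepP a0 i.
by rewrite !mnm0E leqn0.
Qed.

Definition mseries_maxideal : ideal (mseries n k) :=
  Submodule mseries_maxideal_closed.

Lemma mscoef_exp_small (h : mseries n k) j m :
  mscoef h 0%MM = 0 -> (mdeg m < j)%N -> mscoef (h ^+ j) m = 0.
Proof.
move=> h0; elim: j m => // j IHj m mj; rewrite exprS (@mscoefM _ _ (mdeg m).+1) //.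
rewrite big1 // => a am; have [->|a0] := eqVneq (bmnm a) 0%MM.
  by rewrite h0 mul0r.
rewrite IHj ?mulr0 //; rewrite ltnS in mj; apply: leq_trans mj.
have mE : mdeg m = (mdeg (m - a)%MM + mdeg a)%N by rewrite -mdegD submK.
by rewrite [X in (_ < X)%N]mE -[X in (X < _)%N]addn0 ltn_add2l lt0n mdeg_eq0.
Qed.

Lemma mseries_inv (f : mseries n k) :
  mscoef f 0%MM = 1 -> exists g, g * f = 1.
Proof.
move=> f0; pose h := 1 - f.
have h0 : mscoef h 0%MM = 0 by rewrite mscoefD mscoefN mscoef1 eqxx f0 subrr.
pose S N := \sum_(j < N) h ^+ j.
have SE N m : (mdeg m < N)%N -> mscoef (S N) m = mscoef (S (mdeg m).+1) m.
  elim: N => // N IHN; rewrite ltnS leq_eqVlt => /predU1P [->//|mN].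
  by rewrite /S big_ord_recr mscoefD -/(S N) IHN // mscoef_exp_small // addr0.
exists (MSeries (fun m => mscoef (S (mdeg m).+1) m)); apply: mseriesP => m.
set N := (mdeg m).+1.
transitivity (mscoef (S N * f) m).
  rewrite !(@mscoefM _ _ N) //; apply: eq_bigr => a am.
  by congr (_ * _); rewrite (SE N) // ltnS mdeg_le.
have -> : S N * f = 1 - h ^+ N.
  have -> : f = - (h - 1) by rewrite /h addrAC subrr add0r opprK.
  by rewrite mulrN mulrC -subrX1 opprB.
by rewrite mscoefD mscoefN mscoef_exp_small // oppr0 addr0.
Qed.

Lemma mseries_maxideal_neq1 : 1 \notin mseries_maxideal.
Proof. by rewrite inE mscoef1 eqxx oner_eq0. Qed.

Lemma mseries_maxideal_max (J : ideal (mseries n k)) :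
  1 \notin J -> {subset J <= mseries_maxideal}.
Proof.
move=> J1 f fJ; rewrite inE; apply: contraNT J1 => f0.
pose c : mseries n k := mseriesC n (mscoef f 0%MM)^-1.
have cf0 : mscoef (c * f) 0%MM = 1.
  rewrite (@mscoefM _ _ 1) ?mdeg0 // (bigD1 bm0) ?lepm_refl //= subm0 eqxx.
  rewrite mulVf // big1 ?addr0 // => a /andP [_ a0].
  by rewrite -(bmeqP a bm0) (negbTE a0) mul0r.
have [g <-] := mseries_inv cf0.
by rewrite mulrA; apply: (rpredZ (g * c)).
Qed.

End MaximalIdeal.

Section InverseSystems.
Variables (n : nat) (k : fieldType).
Local Notation R := (mseries n k).
Local Notation S := {mpoly k[n]}.
Implicit Types (I K : ideal R) (M : submodule S) (F G : S).

Definition annihilator_pred F : {pred R^o} := [pred f | contract f F == 0].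

Fact annihilator_closed F : submod_closed (annihilator_pred F).
Proof.
split=> [|f g h]; rewrite !inE ?contract0l // => /eqP gF /eqP hF.
by rewrite contractDl hF addr0 contractM gF contract0r.
Qed.

Definition annihilator F : ideal R := Submodule (annihilator_closed F).

Definition cyclic F : {pred S} := [pred G | `[< exists f, G = contract f F >] ].

Definition perp_pred I : {pred S} :=
  [pred G | `[< forall f, f \in I -> contract f G = 0 >] ].

Fact perp_closed I : submod_closed (perp_pred I).
Proof.
split=> [|a G H]; first by apply/asboolP => f _; rewrite contract0r.
move=> /asboolP GI /asboolP HI; apply/asboolP => f fI.
by rewrite contractZDr GI // HI // scaler0 addr0.
Qed.

(* This and [integral] are R-submodules; they are bundled as k-subspaces
   because the quotient [LA] is taken as a k-vector space. *)
Definition perp I : submodule S := Submodule (perp_closed I).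

Lemma perp_contract I f G : G \in perp I -> contract f G \in perp I.
Proof.
move=> /asboolP GI; apply/asboolP => g gI; rewrite -contractM.
by apply: GI; rewrite mulrC; apply: (rpredZ f).
Qed.

Definition integral_pred K M : {pred S} :=
  [pred G | `[< forall f, f \in K -> contract f G \in M >] ].

Fact integral_closed K M : submod_closed (integral_pred K M).
Proof.
split=> [|a G H]; first by apply/asboolP => f _; rewrite contract0r rpred0.
move=> /asboolP GK /asboolP HK; apply/asboolP => f fK.
by rewrite contractZDr rpredD ?rpredZ ?GK ?HK.
Qed.

Definition integral K M : submodule S := Submodule (integral_closed K M).

Definition Gorenstein_cover I F : Prop := {subset perp I <= cyclic F}.

(* l(R/Ann F) - l(R/I) = c *)
Definition cover_colength I F (c : nat) : Prop :=
  exists lA lG, [/\ has_ring_length (quotring I) lA,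
    has_ring_length (quotring (annihilator F)) lG & lG = (lA + c)%N].

(* A relation rather than a function: gcl(R/I) = t, the minimum being attained. *)
Definition Gorenstein_colength I (t : nat) : Prop :=
  (exists F, Gorenstein_cover I F /\ cover_colength I F t) /\
  (forall F c, Gorenstein_cover I F -> cover_colength I F c -> (t <= c)%N).

Definition minimal_Gorenstein_cover I F : Prop :=
  Gorenstein_cover I F /\
  exists2 t, Gorenstein_colength I t & cover_colength I F t.

End InverseSystems.

Section Subquotient.
Variables (R : pzRingType) (V : lmodType R) (U W : submodule V).

Definition restrict_pred : {pred submod_type U} := [pred u | submod_val u \in W].

Fact restrict_closed : submod_closed restrict_pred.
Proof.
split=> [|a u v]; rewrite !inE; first exact: rpred0.
by move=> uW vW; rewrite rpredD // rpredZ.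
Qed.

(* U / (U :&: W) *)
Definition subquot : lmodType R := quotmod (Submodule restrict_closed).

Definition subquot_class (v : V) (vU : v \in U) : subquot :=
  quotmod_pi _ (SubmodType vU).

End Subquotient.

Section ProjectiveSpace.
Variables (k : fieldType) (V : lmodType k).
Local Open Scope classical_set_scope.

Definition line (v : V) : set V := [set w | exists a : k, w = a *: v].

Record proj := Proj {
  proj_line : set V;
  proj_lineP : exists2 v, v != 0 & proj_line = line v }.

Definition proj_point (v : V) (v0 : v != 0) : proj :=
  @Proj (line v) (ex_intro2 _ _ v v0 erefl).

(* Basis-free form of a homogeneous polynomial in the coordinates on V: a
   homogeneous p evaluated at finitely many linear forms. *)
Definition homogeneous_function (f : V -> k) : Prop :=
  exists (m d : nat) (l : 'I_m -> {scalar V}) (p : {mpoly k[m]}),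
    p \is d.-homog /\ forall v, f v = p.@[fun i => l i v].

Definition zariski_closed (Z : set proj) : Prop :=
  exists E : set (V -> k),
    (forall f, E f -> homogeneous_function f) /\
    Z = [set P : proj | forall f, E f -> forall v, proj_line P v -> f v = 0].

Definition zariski_open (Z : set proj) : Prop := zariski_closed (~` Z).

Definition zariski_locally_closed (Z : set proj) : Prop :=
  exists C U, [/\ zariski_closed C, zariski_open U & Z = C `&` U].

End ProjectiveSpace.

Definition LA (n : nat) (k : fieldType) (I : ideal (mseries n k)) (t : nat) :
    lmodType k :=
  subquot (integral (ideal_exp (mseries_maxideal n k) t) (perp I)) (perp I).

Definition LA_class (n : nat) (k : fieldType) (I : ideal (mseries n k)) (t : nat)
    (F : {mpoly k[n]})
    (hF : F \in integral (ideal_exp (mseries_maxideal n k) t) (perp I)) :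
  LA I t := subquot_class (perp I) hF.

(* Main.v *)
(* Inside the polynomials of degree < d, with d large, <F> is the row space of
   the catalecticant matrix M(F), with rows x^a o F and entries linear in F, and
   l(R/Ann F) = rank M(F), since a proper submodule of <F> always has a vector
   of <F> outside it that the maximal ideal sends into it. If P has row space
   I^perp and e = l(A) + t, then F is a minimal cover iff P <= M(F) and
   rank M(F) = e, that is, iff rank M(F) >= e and the rank of M(F) modulo I^perp
   is at most e - rank P: an open and a closed determinantal condition. They
   are pulled back along a linear lift L_{A,t} -> S, because minimal covers
   outside I^perp are stable under adding elements of I^perp. *)
Require Import Defs.
From HB Require Import structures.
From mathcomp Require Import all_boot all_order all_algebra.
From mathcomp Require Import boolp classical_sets mpoly.

Set Implicit Arguments.
Unset Strict Implicit.
Unset Printing Implicit Defensive.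

Import GRing.Theory.
Local Open Scope ring_scope.

(** * Rank conditions, and subspaces of row vectors as row spaces *)

Section RowSpaces.
Variable k : fieldType.

(** Compressions by arbitrary [A] and [B] play the role of minors: no rows or columns have to be
    selected, and the rank condition still becomes the nonvanishing of some determinant. *)
Lemma rank_geP r p q (X : 'M[k]_(p, q)) :
  (r <= \rank X)%N <->
  exists (A : 'M_(r, p)) (B : 'M_(q, r)), \det (A *m X *m B) != 0.
Proof.
split=> [rX|[A [B]]]; last first.
  rewrite -unitfE -unitmxE -row_full_unit => /eqP <-.
  exact: leq_trans (mxrankM_maxl _ _) (mxrankM_maxr _ _).
(* Cancelling the invertible factors of [X = col_ebase X *m pid_mx (\rank X) *m row_ebase X] leaves
   the identity of size [r]. *)
exists (pid_mx r *m invmx (col_ebase X)), (invmx (row_ebase X) *m pid_mx r).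
rewrite -{2}(mulmx_ebase X) !mulmxA mulmxKV ?col_ebase_unit //.
rewrite mulmxK ?row_ebase_unit // !mul_pid_mx.
have ->: minn p (minn r (\rank X)) = r.
  rewrite (minn_idPl rX); apply/minn_idPr.
  by rewrite (leq_trans rX) ?rank_leq_row.
have ->: minn q (minn r r) = r.
  by rewrite minnn; apply/minn_idPr; rewrite (leq_trans rX) ?rank_leq_col.
by rewrite pid_mx_1 det1 oner_eq0.
Qed.

Lemma rank_adds_row N (P : 'M[k]_N) (v : 'rV_N) :
  ~~ (v <= P)%MS -> \rank (P + v)%MS = (\rank P).+1.
Proof.
move=> vP; apply/eqP; rewrite eqn_leq; apply/andP; split.
  apply: leq_trans (mxrank_adds_leqif _ _) _.
  by have := rank_leq_row v; rewrite -(leq_add2l (\rank P)) addn1.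
rewrite ltn_neqAle mxrankS ?addsmxSl // andbT; apply: contraNneq vP => rPv.
apply: submx_trans (addsmxSr P v) _.
have := mxrank_leqif_sup (addsmxSl P v); rewrite rPv => /leqifP.
by case: ifP => //; rewrite ltnn.
Qed.

(** A row space of maximal rank inside [W] is all of [W], since any missing vector could be
    adjoined. *)
Lemma subspace_mx N (W : 'rV[k]_N -> Prop) :
  W 0 -> (forall a u v, W u -> W v -> W (a *: u + v)) ->
  exists P : 'M[k]_N, forall v, W v <-> (v <= P)%MS.
Proof.
move=> W0 WD.
pose Q r := `[< exists P : 'M[k]_N,
  (forall v : 'rV_N, (v <= P)%MS -> W v) /\ \rank P = r >].
have exQ : exists r, Q r.
  exists 0%N; apply/asboolP; exists 0; rewrite mxrank0; split=> // v.
  by move/submx0null ->.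
have ubQ r : Q r -> (r <= N)%N by case/asboolP => P [_ <-]; apply: rank_leq_row.
case: (ex_maxnP exQ ubQ) => r /asboolP [P [PW rP]] rmax.
exists P => v; split=> [Wv|]; last exact: PW.
apply: contraT => vP; suff : (r.+1 <= r)%N by rewrite ltnn.
apply: rmax; apply/asboolP; exists (P + v)%MS; rewrite rank_adds_row // rP.
split=> // u /sub_addsmxP [[u1 u2] /= ->]; rewrite addrC.
rewrite [u2]mx11_scalar mul_scalar_mx; apply: WD => //.
by apply: PW; apply: submxMl.
Qed.

Lemma kermx_coker N (P : 'M[k]_N) : (kermx (cokermx P) :=: P)%MS.
Proof.
by apply/eqmxP; rewrite submxE mulmx_ker eqxx sub_kermx mulmx_coker eqxx.
Qed.

(** [\rank (M *m cokermx P)] is the rank of [M] modulo the row space of [P]; together with the rank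
    of the intersection of [M] and [P] it adds up to [\rank M]. The bounds force that intersection
    to have the full rank of [P]. *)
Lemma rank_mul_coker m N (M : 'M[k]_(m, N)) (P : 'M_N) r :
  (r <= \rank M)%N -> (\rank (M *m cokermx P) <= r - \rank P)%N ->
  (\rank P <= r)%N -> \rank M = r /\ (P <= M)%MS.
Proof.
move=> rM rMC Pr; have := mxrank_mul_ker M (cokermx P).
rewrite (cap_eqmx (eqmx_refl M) (kermx_coker P)) => rE.
have capP : (\rank (M :&: P)%MS <= \rank P)%N by rewrite mxrankS ?capmxSr.
have rM' : (\rank M <= r)%N by rewrite -rE -(subnK Pr) leq_add.
split; first by apply/eqP; rewrite eqn_leq rM'.
have := mxrank_leqif_sup (capmxSr M P) => /leqifP; case: ifP => [|_].
  by rewrite sub_capmx => /andP[].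
rewrite ltnNge -(leq_add2l (r - \rank P)) subnK // => /negP[].
by apply: leq_trans rM _; rewrite -rE leq_add2r.
Qed.

Lemma rank_mul_coker_sub m N (M : 'M[k]_(m, N)) (P : 'M_N) :
  (P <= M)%MS -> \rank (M *m cokermx P) = (\rank M - \rank P)%N.
Proof.
move=> PM; have := mxrank_mul_ker M (cokermx P).
rewrite (cap_eqmx (eqmx_refl M) (kermx_coker P)) (capmx_idPr PM) => <-.
by rewrite addnK.
Qed.

End RowSpaces.

(** * Determinants of linear matrices as homogeneous functions *)

Section Homogeneous.
Variables (k : fieldType) (V : lmodType k).

(** The generic determinant in [r * r] variables is homogeneous of degree [r]; it is evaluated at
    the entries of [L v], which are linear forms. *)
Lemma det_homogeneous r (L : V -> 'M[k]_r) :
  linear L -> homogeneous_function (fun v => \det (L v)).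
Proof.
move=> Llin.
have entry (i : 'I_(r * r)) : linear_for *%R (fun v => mxvec (L v) 0 i).
  by move=> a u v; rewrite Llin linearP !mxE.
pose l (i : 'I_(r * r)) : {scalar V} :=
  HB.pack (fun v => mxvec (L v) 0 i) (GRing.isLinear.Build _ _ _ _ _ (entry i)).
pose X : 'M[{mpoly k[r * r]}]_r := \matrix_(i, j) 'X_(mxvec_index i j).
exists (r * r)%N, r, l, (\det X); split.
  rewrite /determinant; apply: rpred_sum => s _; rewrite rpredMsign.
  under eq_bigr => i _ do rewrite mxE.
  rewrite mprodXE dhomogX; apply/eqP; rewrite -[RHS]card_ord -sum1_card.
  apply: etrans (mdeg_sum _ _ _) _.
  by apply: eq_bigr => i _; rewrite mdeg1.
move=> v; rewrite -det_map_mx; congr (\det _); apply/matrixP => i j.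
by rewrite [RHS]mxE /= mxE mevalXU /= mxvecE.
Qed.

End Homogeneous.

(** * Coefficient rows and catalecticant matrices *)

Section Catalecticant.
Variables (n : nat) (k : fieldType) (d : nat).
Local Notation R := (mseries n k).
Local Notation S := {mpoly k[n]}.
Local Notation N := #|{: 'X_{1..n < d}}|.

Definition deg_lt e (G : S) : Prop := forall m, (e <= mdeg m)%N -> G@_m = 0.

Definition mon (i : 'I_N) : 'X_{1..n} := bmnm (enum_val i).

Definition coefrow (G : S) : 'rV[k]_N := \row_i G@_(mon i).

Definition rowpoly (v : 'rV[k]_N) : S := \sum_i v 0 i *: 'X_[mon i].

Definition mseriesX (a : 'X_{1..n}) : R := MSeries (fun m => (m == a)%:R).

Definition cat_mx (F : S) : 'M[k]_N :=
  \matrix_(i, j) (contract (mseriesX (mon i)) F)@_(mon j).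

Lemma mon_surj m : (mdeg m < d)%N -> exists i, m = mon i.
Proof.
by move=> md; exists (enum_rank (BMultinom md)); rewrite /mon enum_rankK.
Qed.

Lemma coefrow_linear a G H : coefrow (a *: G + H) = a *: coefrow G + coefrow H.
Proof. by apply/rowP => i; rewrite !mxE mcoeffD mcoeffZ. Qed.

Lemma cat_mx_linear a F G : cat_mx (a *: F + G) = a *: cat_mx F + cat_mx G.
Proof. by apply/matrixP => i j; rewrite !mxE contractZDr mcoeffD mcoeffZ. Qed.

Lemma coefrow0 : coefrow 0 = 0.
Proof. by apply/rowP => i; rewrite !mxE mcoeff0. Qed.

Lemma coefrow_inj G H :
  deg_lt d G -> deg_lt d H -> coefrow G = coefrow H -> G = H.
Proof.
move=> Gd Hd GH; apply/mpolyP => m; case: (ltnP (mdeg m) d) => md; last first.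
  by rewrite Gd // Hd.
by have [i ->] := mon_surj md; have /rowP/(_ i) := GH; rewrite !mxE.
Qed.

Lemma mcoeff_rowpoly v m : (rowpoly v)@_m = \sum_i v 0 i * (mon i == m)%:R.
Proof.
by rewrite raddf_sum; apply: eq_bigr => i _; rewrite /= mcoeffZ mcoeffX.
Qed.

Lemma mon_inj : injective mon.
Proof. by move=> i j /val_inj /enum_val_inj. Qed.

Lemma rowpolyK : cancel rowpoly coefrow.
Proof.
move=> v; apply/rowP => j; rewrite mxE mcoeff_rowpoly (bigD1 j) //= eqxx mulr1.
rewrite big1 ?addr0 // => i ij.
case: eqP => [/mon_inj E|_]; last by rewrite mulr0.
by rewrite E eqxx in ij.
Qed.

Lemma rowpoly_deg v : deg_lt d (rowpoly v).
Proof.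
move=> m dm; rewrite mcoeff_rowpoly big1 // => i _; case: eqP => [E|_].
  by have := bmdeg (enum_val i); rewrite -/(mon i) E ltnNge dm.
by rewrite mulr0.
Qed.

Lemma rowpoly_linear a u v : rowpoly (a *: u + v) = a *: rowpoly u + rowpoly v.
Proof.
apply: coefrow_inj; first exact: rowpoly_deg.
  move=> m dm; rewrite mcoeffD mcoeffZ !rowpoly_deg // mulr0 addr0 //.
by rewrite coefrow_linear !rowpolyK.
Qed.

Lemma contract_deg f F : deg_lt d F -> deg_lt d (contract f F).
Proof. exact: contract_out. Qed.

(** Each monomial of a series without constant term lowers the degree by at least one. *)
Lemma contract_deg_pred e f F :
  mscoef f 0%MM = 0 -> deg_lt e.+1 F -> deg_lt e (contract f F).
Proof.
move=> f0 Fe m em; rewrite (contractE _ _ Fe) big1 // => b mb.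
have [E|ne] := eqVneq (b - m)%MM 0%MM; first by rewrite E f0 mul0r.
have := bmdeg b; rewrite -(submK mb) mdegD => lt.
move: ne; rewrite -mdeg_eq0 -lt0n => gt0.
by have := leq_add gt0 em; rewrite add1n leqNgt lt.
Qed.

(** Coefficients of [f] in degree [d] or more act by zero on [F], so the finite row of the lower
    ones determines the contraction. *)
Lemma coefrow_contract f F : deg_lt d F ->
  coefrow (contract f F) = (\row_i mscoef f (mon i)) *m cat_mx F.
Proof.
move=> Fd; apply/rowP => j; rewrite !mxE (contractE _ _ Fd).
under [RHS]eq_bigr => i _ do rewrite !mxE (contractE _ _ Fd) mulr_sumr.
rewrite exchange_big /=; apply: eq_bigr => b jb.
have bd : (mdeg (b - mon j)%MM < d)%N.
  by rewrite (leq_ltn_trans _ (bmdeg b)) ?mdegB.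
have [i E] := mon_surj bd; rewrite (bigD1 i) //= E eqxx mul1r big1 ?addr0 //.
move=> i' ne; case: eqP => [/mon_inj Ei|_]; last by rewrite mul0r mulr0.
by rewrite Ei eqxx in ne.
Qed.

Lemma cat_mxP F (v : 'rV[k]_N) : deg_lt d F ->
  (v <= cat_mx F)%MS <-> exists f, v = coefrow (contract f F).
Proof.
move=> Fd; split=> [/submxP [u ->]|[f ->]]; last first.
  by rewrite coefrow_contract // submxMl.
(* The coefficients [u] of the row combination form a polynomial, which is read as a power
   series. *)
exists (MSeries (fun m => (rowpoly u)@_m)); rewrite coefrow_contract //.
congr (_ *m _); rewrite -[LHS]rowpolyK.
by apply/rowP => i; rewrite !mxE.
Qed.

Lemma cat_mx_contract f F :
  deg_lt d F -> (cat_mx (contract f F) <= cat_mx F)%MS.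
Proof.
move=> Fd; apply/row_subP => i; apply/cat_mxP => //.
exists (mseriesX (mon i) * f); rewrite contractM.
by apply/rowP => j; rewrite !mxE.
Qed.


Lemma contract_mseriesX a (F : S) c :
  (contract (mseriesX a) F)@_c = F@_(c + a)%MM.
Proof.
pose e := maxn (msize F) (mdeg (c + a)%MM).+1.
have Fe : deg_lt e F.
  by move=> m em; apply: msize_out; apply: leq_trans em; apply: leq_maxl.
have cae : (mdeg (c + a)%MM < e)%N by rewrite leq_maxr.
have ca : (c <= c + a)%MM by rewrite addmC lem_addl.
rewrite (contractE _ _ Fe) (bigD1 (BMultinom cae)) //=.
have -> : (c + a - c)%MM = a by rewrite addmC addmK.
rewrite eqxx mul1r.
rewrite big1 ?addr0 // => b /andP [cb ne].
case: eqP => [E|_]; last by rewrite mul0r.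
by case/negP: ne; apply/eqP/val_inj; rewrite /= -(submK cb) E addmC.
Qed.

Lemma contractC (c : k) (F : S) : contract (mseriesC n c) F = c *: F.
Proof.
rewrite -{2}[F]contract1; apply/mpolyP => m; rewrite mcoeffZ.
rewrite !(contractE _ _ (@msize_out n k F)) mulr_sumr; apply: eq_bigr => b _.
by rewrite mscoef1 mulrA /=; case: eqP; rewrite ?mulr1 // !mul0r mulr0 mul0r.
Qed.

Lemma contractB (f g : R) (F : S) :
  contract (f - g) F = contract f F - contract g F.
Proof. by rewrite -{2}(subrK g f) (contractDl (f - g) g) addrK. Qed.

(** * The length of R/Ann F as the rank of the catalecticant *)

Section Length.
Variable F : S.
Hypothesis Fd : deg_lt d F.
Local Notation Q := (quotring (annihilator F)).
Local Notation orbit f := (coefrow (contract f%R F)).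

Lemma orbitD f g : orbit (f + g) = orbit f + orbit g.
Proof.
by rewrite contractDl -[contract f F]scale1r coefrow_linear !scale1r.
Qed.

Lemma orbitC (c : k) f : orbit (mseriesC n c * f) = c *: orbit f.
Proof.
rewrite contractM contractC -[c *: contract f F]addr0.
by rewrite coefrow_linear coefrow0 addr0.
Qed.

Lemma orbit_eq f g : orbit f = orbit g <->
  quotring_pi (annihilator F) f = quotring_pi (annihilator F) g.
Proof.
split=> [E|/quotring_piP]; last first.
  by rewrite inE contractB subr_eq0 => /eqP ->.
apply/quotring_piP; rewrite inE contractB subr_eq0.
by rewrite (coefrow_inj _ _ E) ?eqxx //; apply: contract_deg.
Qed.

Lemma orbit_repr f : orbit (repr (quotring_pi (annihilator F) f)) = orbit f.
Proof. by apply/orbit_eq; rewrite quotring_reprK. Qed.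

(** Through the map sending f to f o F, such row spaces inside [cat_mx F] stand for the submodules
    of <F>, hence for the ideals of R/Ann F. *)
Definition contract_stable (A : 'M[k]_N) :=
  forall f g, (orbit g <= A)%MS -> (orbit (f * g) <= A)%MS.

Lemma contract_stable_ideal A : contract_stable A ->
  exists J : submodule Q^o, forall x : Q, x \in J = (orbit (repr x) <= A)%MS.
Proof.
move=> stA.
have clA : submod_closed [pred x : Q^o | (orbit (repr (x : Q)) <= A)%MS].
  split=> [|a x y]; rewrite !inE.
    have -> : (0 : Q) = quotring_pi _ 0 by rewrite /quotring_pi raddf0.
    by rewrite orbit_repr contract0l coefrow0; apply: sub0mx.
  have -> : a *: x + y =
      quotring_pi (annihilator F) (repr (a : Q) * repr (x : Q) + repr (y : Q)).
    by rewrite quotring_piD -quotring_mulE !quotring_reprK.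
  by move=> xA yA; rewrite orbit_repr orbitD addmx_sub ?stA.
by exists (Submodule clA).
Qed.

(** As long as some [f] in the maximal ideal keeps the orbit of [f * g] outside [A], replace [g] by
    [f * g]. The degree drops each time, so this stops. *)
Lemma socle_orbit (A : 'M[k]_N) g : ~~ (orbit g <= A)%MS ->
  exists2 h, ~~ (orbit h <= A)%MS &
    forall f, mscoef f 0%MM = 0 -> (orbit (f * h) <= A)%MS.
Proof.
have : deg_lt d (contract g F) by apply: contract_deg.
(* Only the degree bound on [contract g F] is generalized for the induction; the size of the
   coefficient rows stays [d]. *)
move: {1}d => e; elim: e g => [|e IHe] g ge gA.
  case/negP: gA; rewrite (_ : contract g F = 0) ?coefrow0 ?sub0mx //.
  by apply/mpolyP => m; rewrite mcoeff0 ge.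
case: (pselect (exists2 f, mscoef f 0%MM = 0 & ~~ (orbit (f * g) <= A)%MS)).
  by case=> f f0; apply: IHe; rewrite contractM; apply: contract_deg_pred.
move=> nex; exists g => // f f0; apply: contraT => fgA.
by case: nex; exists f.
Qed.

(** Adjoining one vector given by [socle_orbit] suffices: modulo [A], a series acts on it through
    its constant term, so the enlarged space stays stable. *)
Lemma contract_stable_extend A : contract_stable A -> (A <= cat_mx F)%MS ->
    (\rank A < \rank (cat_mx F))%N ->
  exists B, [/\ contract_stable B, (A <= B)%MS, (B <= cat_mx F)%MS &
    \rank B = (\rank A).+1].
Proof.
move=> stA AF; rewrite ltnNge => rAF.
have /row_subPn [i] : ~~ (cat_mx F <= A)%MS.
  by apply: contra rAF; apply: mxrankS.
have /(cat_mxP _ Fd) [g ->] := row_sub i (cat_mx F).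
case/socle_orbit => h hA hm; exists (A + orbit h)%MS; split.
- move=> f g' /sub_addsmxP [[u1 u2] /=]; rewrite [u2]mx11_scalar mul_scalar_mx.
  set c := u2 0 0 => E.
  (* Removing the component of [g'] along [h] brings it back into [A], where stability is known. *)
  have gA : (orbit (g' - mseriesC n c * h) <= A)%MS.
    have -> : orbit (g' - mseriesC n c * h) = u1 *m A; last exact: submxMl.
    apply: (addIr (orbit (mseriesC n c * h))).
    by rewrite -orbitD subrK orbitC.
  have -> : f * g' = f * (g' - mseriesC n c * h) + mseriesC n c * (f * h).
    by rewrite mulrBr (mulrCA f) subrK.
  rewrite orbitD orbitC addmx_sub //.
    by apply: submx_trans (addsmxSl _ _); apply: stA.
  apply: scalemx_sub.
  (* Split [f] into its constant term, which rescales [h], and a part in the maximal ideal, which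
     sends [h] into [A]. *)
  pose f0 : R := mseriesC n (mscoef f 0%MM).
  have -> : f * h = (f - f0) * h + f0 * h by rewrite -mulrDl subrK.
  rewrite orbitD orbitC addmx_sub ?scalemx_sub ?addsmxSr //.
  apply: submx_trans (addsmxSl _ _); apply: hm.
  by rewrite mscoefD mscoefN /= eqxx subrr.
- exact: addsmxSl.
- by rewrite addsmx_sub AF; apply/cat_mxP => //; exists h.
- exact: rank_adds_row.
Qed.

Lemma contract_stable_flag r : (r <= \rank (cat_mx F))%N ->
  exists W : nat -> 'M[k]_N, [/\ forall i, contract_stable (W i),
    forall i, (W i <= cat_mx F)%MS,
    forall i, (i <= r)%N -> \rank (W i) = i &
    forall i, (i < r)%N -> (W i <= W i.+1)%MS].
Proof.
elim: r => [|r IHr] rF.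
  exists (fun=> 0); split=> // [i f g|i|i].
  - move/submx0null => E; rewrite (_ : orbit (f * g) = 0) ?sub0mx //.
    rewrite contractM; suff -> : contract g F = 0.
      by rewrite contract0r coefrow0.
    apply: coefrow_inj; first exact: contract_deg.
      by move=> m _; rewrite mcoeff0.
    by rewrite coefrow0.
  - exact: sub0mx.
  - by rewrite leqn0 mxrank0 => /eqP.
have [W [stW WF rW sW]] := IHr (ltnW rF).
have [|B [stB WB BF rB]] := contract_stable_extend (stW r) (WF r).
  by rewrite rW.
exists (fun i => if (i <= r)%N then W i else B); split=> [i|i|i|i].
- by case: ifP.
- by case: ifP.
- case: (leqP i r) => [ir _|ri ir]; first exact: rW.
  by rewrite rB rW //; apply/eqP; rewrite eqn_leq ri.
- rewrite ltnS => ir; rewrite ir; case: (ltnP i r) => [|ri]; first exact: sW.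
  by have -> : i = r by apply/eqP; rewrite eqn_leq ir.
Qed.

(** Each strict inclusion supplies a class whose orbit is independent of those already collected, so
    a chain of length [l] yields [l] independent vectors of <F>. *)
Lemma strict_chain_rank (W : nat -> submodule Q^o) l :
  strict_chain W l -> (l <= \rank (cat_mx F))%N.
Proof.
move=> chW.
suff /(_ l (leqnn l)) [B <- BW] : forall i, (i <= l)%N -> exists2 B : 'M[k]_N,
    \rank B = i &
    forall u : 'rV_N, (u <= B)%MS ->
      exists2 x : Q, x \in W i & u = orbit (repr x).
  apply: mxrankS; apply/row_subP => i; apply/cat_mxP => //.
  by have [x _ ->] := BW _ (row_sub i B); exists (repr x).
elim=> [_|i IHi il].
  exists 0 => [|u /submx0null ->]; first exact: mxrank0.
  exists 0; first exact: rpred0.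
  have -> : (0 : Q) = quotring_pi _ 0 by rewrite /quotring_pi raddf0.
  by rewrite orbit_repr contract0l coefrow0.
have [B rB BW] := IHi (ltnW il); have [sW nW] := chW _ il.
have [x xW xnW] : exists2 x : Q, x \in W i.+1 & x \notin W i.
  apply: contrapT => nex; apply: nW => x xW; apply: contraT => xnW.
  by case: nex; exists x.
exists (B + orbit (repr x))%MS => [|u].
  (* If the new orbit were in [B], it would be the orbit of some [y] in [W i]; equal orbits mean
     equal classes, so [x] would lie in [W i]. *)
  rewrite rank_adds_row ?rB //; apply: contra xnW => /BW [y yW].
  by move/orbit_eq; rewrite !quotring_reprK => ->.
case/sub_addsmxP => [[u1 u2] /= ->]; rewrite [u2]mx11_scalar mul_scalar_mx.
have [y yW ->] := BW _ (submxMl u1 B).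
exists (quotring_pi _ (mseriesC n (u2 0 0)) * x + y).
  have := (submod_closedP (W i.+1)).2 (quotring_pi _ (mseriesC n (u2 0 0))) x y.
  by apply; [|apply: sW].
rewrite -{2}[x]quotring_reprK -{2}[y]quotring_reprK.
by rewrite [_ * _]quotring_mulE -quotring_piD orbit_repr orbitD orbitC addrC.
Qed.

Lemma length_annihilator :
  has_ring_length (quotring (annihilator F)) (\rank (cat_mx F)).
Proof.
split; last exact: strict_chain_rank.
have [W [stW WF rW sW]] := contract_stable_flag (leqnn _).
have [J JE] := choice (fun i => contract_stable_ideal (stW i)).
exists J => i il; split=> [x|sub].
  by rewrite !JE => /submx_trans; apply; apply: sW.
suff : (W i.+1 <= W i)%MS by move/mxrankS; rewrite !rW // ?ltnn // ltnW.
apply/row_subP => j.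
have /(cat_mxP _ Fd) [f E] := submx_trans (row_sub j _) (WF i.+1).
have := sub (quotring_pi _ f); rewrite !JE orbit_repr -E; apply.
exact: row_sub.
Qed.

End Length.

End Catalecticant.

(** * Determinantal equations on projective space *)

Section Minors.
Variables (k : fieldType) (V : lmodType k) (N p : nat).

Definition minors r (L : V -> 'M[k]_(N, p)) : set (V -> k) :=
  fun f => exists (A : 'M_(r, N)) (B : 'M_(p, r)),
    f = fun v => \det (A *m L v *m B).

Lemma minors_homogeneous r (L : V -> 'M[k]_(N, p)) f :
  linear L -> minors r L f -> homogeneous_function f.
Proof.
move=> Llin [A [B ->]]; apply: det_homogeneous => a u v.
by rewrite Llin mulmxDr mulmxDl -scalemxAr -scalemxAl.
Qed.

(** The functions must vanish on the whole line, as in [zariski_closed]; this costs nothing since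
    rescaling [c] cannot raise the rank. *)
Lemma minors_vanish r (L : V -> 'M[k]_(N, p)) c : linear L ->
  (forall f, minors r L f -> forall v, line c v -> f v = 0) <->
  (\rank (L c) < r)%N.
Proof.
move=> Llin; split=> [vanish|rc f [A [B ->]] v [a ->]].
  rewrite ltnNge; apply/negP => /rank_geP [A [B]] /eqP; apply.
  apply: (vanish (fun v => \det (A *m L v *m B))); first by exists A, B.
  by exists 1; rewrite scale1r.
apply/eqP; apply: contraTT rc => det0; rewrite -leqNgt.
have L0 : L 0 = 0.
  by have := Llin (-1) 0 0; rewrite scaler0 addr0 scaleN1r addNr.
have rac : (\rank (L (a *: c)) <= \rank (L c))%N.
  by rewrite -[a *: c]addr0 Llin L0 addr0; apply/mxrankS/scalemx_sub.
by apply: leq_trans rac; apply/rank_geP; exists A, B.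
Qed.

End Minors.

(** * Degree bounds and Gorenstein covers in terms of matrices *)

Section Covers.
Variables (n : nat) (k : fieldType).
Local Notation R := (mseries n k).
Local Notation S := {mpoly k[n]}.
Implicit Types (I : ideal R) (F G : S).

(** Induction on [t]: contracting by a variable that divides the monomial [m] moves its coefficient
    one degree down and uses up one factor of the maximal ideal. *)
Lemma integral_deg_lt I e t F :
    (forall G, G \in perp I -> deg_lt e G) ->
    F \in integral (ideal_exp (mseries_maxideal n k) t) (perp I) ->
  deg_lt (e + t) F.
Proof.
move=> Ie /asboolP FI.
have {FI} : forall f, f \in ideal_exp (mseries_maxideal n k) t ->
    deg_lt e (contract f F) by move=> f /FI /Ie.
elim: t F => [|t IHt] F Fe m em.
  by have := Fe 1 isT; rewrite contract1; apply; rewrite addn0 in em.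
have [i mi] : exists i, (U_(i) <= m)%MM.
  case: (pselect (exists i, m i != 0%N)) => [[i mi]|nex].
    by exists i; rewrite lep1mP.
  suff m0 : m = 0%MM by rewrite m0 mdeg0 addnS in em.
  apply/mnmP => i; rewrite mnm0E; apply/eqP; apply: contraT => mi.
  by case: nex; exists i.
rewrite -(submK mi) -contract_mseriesX; apply: IHt => [f ft|].
  rewrite -contractM mulrC; apply: Fe; apply/asboolP.
  exists [:: (mseriesX k U_(i)%MM, f)]; rewrite big_seq1; split=> //=.
  rewrite ft !andbT inE /=; apply/eqP; case: eqP => // /(congr1 mdeg).
  by rewrite mdeg0 mdeg1.
by move: em; rewrite -{1}(submK mi) mdegD mdeg1 addn1 addnS ltnS.
Qed.

Lemma has_length_unique (T : pzRingType) (V : lmodType T) l l' :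
  has_length V l -> has_length V l' -> l = l'.
Proof.
move=> [[W Wl] maxl] [[W' Wl'] maxl'].
by apply/eqP; rewrite eqn_leq (maxl' _ _ Wl) (maxl _ _ Wl').
Qed.

Lemma Gorenstein_colength_unique I t t' :
  Gorenstein_colength I t -> Gorenstein_colength I t' -> t = t'.
Proof.
move=> [[F [FI Ft]] mint] [[G [GI Gt']] mint'].
by apply/eqP; rewrite eqn_leq (mint _ _ GI Gt') (mint' _ _ FI Ft).
Qed.

Variables (d : nat) (I : ideal R).
Hypothesis Id : forall G, G \in perp I -> deg_lt d G.
Local Notation N := #|{: 'X_{1..n < d}}|.

Lemma perp_mx : exists P : 'M[k]_N,
  forall G, deg_lt d G -> G \in perp I = (coefrow d G <= P)%MS.
Proof.
have [||P PE] := @subspace_mx k N (fun v => rowpoly v \in perp I).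
- rewrite (_ : rowpoly 0 = 0) ?rpred0 //.
  by rewrite /rowpoly big1 // => i _; rewrite mxE scale0r.
- by move=> a u v uI vI; rewrite rowpoly_linear rpredD ?rpredZ.
exists P => G Gd; have -> : G = rowpoly (coefrow d G).
  by apply: coefrow_inj Gd _ _; [exact: rowpoly_deg | rewrite rowpolyK].
by rewrite rowpolyK; apply/idP/idP => /PE.
Qed.

Variable P : 'M[k]_N.
Hypothesis PE : forall G, deg_lt d G -> G \in perp I = (coefrow d G <= P)%MS.

(** The row spaces of [P] and [cat_mx d F] are I^perp and <F> in coordinates. *)
Lemma Gorenstein_coverP F : deg_lt d F ->
  Gorenstein_cover I F <-> (P <= cat_mx d F)%MS.
Proof.
move=> Fd; split=> [IF|PF G GI].
  apply/row_subP => i; apply/cat_mxP => //.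
  have /IF /asboolP [f E] : rowpoly (row i P) \in perp I.
    by rewrite PE ?rowpolyK ?row_sub //; apply: rowpoly_deg.
  by exists f; rewrite -E rowpolyK.
have Gd := Id GI; move: GI; rewrite PE // => /submx_trans /(_ PF).
case/(cat_mxP _ Fd) => f E; apply/asboolP; exists f.
by apply: coefrow_inj E => //; apply: contract_deg.
Qed.

Lemma minimal_Gorenstein_coverP F t lA :
    deg_lt d F -> has_ring_length (quotring I) lA -> Gorenstein_colength I t ->
  minimal_Gorenstein_cover I F <->
  (P <= cat_mx d F)%MS /\ \rank (cat_mx d F) = (lA + t)%N.
Proof.
move=> Fd hA gcl; have hF := length_annihilator Fd.
split=> [[/(Gorenstein_coverP Fd) PF [t' gcl' [lA' [lG [hA' hG lGE]]]]]|].
  split=> //; rewrite (Gorenstein_colength_unique gcl gcl').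
  by rewrite (has_length_unique hA hA') -lGE; apply: has_length_unique hF hG.
case=> /(Gorenstein_coverP Fd) IF rF; split=> //; exists t => //.
by exists lA, (\rank (cat_mx d F)).
Qed.

(* Write G - F = f o F. The ideal of all h with h o F in I^perp is proper and
   contains f, so 1 + f is a unit, and G = (1 + f) o F generates <F>. *)
Lemma cover_perturb F G : deg_lt d F -> F \notin perp I -> G - F \in perp I ->
  (P <= cat_mx d F)%MS -> (cat_mx d G :=: cat_mx d F)%MS.
Proof.
move=> Fd FnI HI /(Gorenstein_coverP Fd) IF.
have /asboolP [f E] := IF _ HI.
have f0 : mscoef f 0%MM = 0.
  have clJ : submod_closed [pred h : R^o | contract (h : R) F \in perp I].
    split=> [|a h h' hI hI'].
      by change (contract 0 F \in perp I); rewrite contract0l rpred0.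
    change (contract ((a : R) * h + h') F \in perp I).
    rewrite contractDl contractM; apply: rpredD; last exact: hI'.
    by apply: perp_contract; exact: hI.
  have := @mseries_maxideal_max n k (Submodule clJ).
  have J1 : 1 \notin (Submodule clJ : ideal R).
    by change (contract 1 F \notin perp I); rewrite contract1.
  have fJ : f \in (Submodule clJ : ideal R).
    by change (contract f F \in perp I); rewrite -E.
  by move=> /(_ J1 f fJ); rewrite inE => /eqP.
have [g gf] : exists g, g * (1 + f) = 1.
  by apply: mseries_inv; rewrite mscoefD f0 addr0 mscoef1 eqxx.
have GE : G = contract (1 + f) F by rewrite contractDl contract1 -E addrC subrK.
apply/eqmxP; rewrite {1}GE cat_mx_contract //=.
have -> : F = contract g G by rewrite GE -contractM gf contract1.
by apply: cat_mx_contract; rewrite GE; apply: contract_deg.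
Qed.

End Covers.

(** * A linear lift from the quotient to polynomials *)

Section LinearLift.
Variables (n : nat) (k : fieldType) (d t : nat) (I : ideal (mseries n k)).
Local Notation S := {mpoly k[n]}.
Local Notation N := #|{: 'X_{1..n < d}}|.
Variable P : 'M[k]_N.
Hypothesis Id : forall G, G \in perp I -> deg_lt d G.
Hypothesis PE : forall G, deg_lt d G -> G \in perp I = (coefrow d G <= P)%MS.

(** [cokermx P] kills exactly the row space of [P], so these are coordinates modulo I^perp and do
    not depend on the representative. *)
Definition LA_row (v : LA I t) : 'rV[k]_N :=
  coefrow d (submod_val (repr v)) *m cokermx P.

Lemma LA_row_pi x :
  LA_row (quotmod_pi _ x) = coefrow d (submod_val x) *m cokermx P.
Proof.
have /quotmod_piP := quotmod_reprK (quotmod_pi _ x : LA I t).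
rewrite /LA_row; set y := repr _ => yx.
have {yx} yx : submod_val y - submod_val x \in perp I by exact: yx.
have := yx; rewrite PE ?submxE; last exact: Id.
rewrite -scaleN1r addrC coefrow_linear scaleN1r mulmxDl mulNmx addrC.
by rewrite subr_eq0 => /eqP.
Qed.

Lemma LA_row_linear : linear LA_row.
Proof.
move=> a u v; rewrite -[u]quotmod_reprK -[v]quotmod_reprK.
rewrite [a *: _]quotmod_scaleE -quotmod_piD !LA_row_pi /=.
by rewrite coefrow_linear mulmxDl -scalemxAl.
Qed.

(** The representative [repr v] need not be linear in [v]; [pinvmx] gives a linear choice of
    preimages under [cokermx P]. *)
Definition LA_lift (v : LA I t) : S :=
  rowpoly (LA_row v *m pinvmx (cokermx P)).

Lemma LA_lift_linear a u v : LA_lift (a *: u + v) = a *: LA_lift u + LA_lift v.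
Proof. by rewrite /LA_lift LA_row_linear mulmxDl -scalemxAl rowpoly_linear. Qed.

Lemma LA_lift_deg v : deg_lt d (LA_lift v).
Proof. exact: rowpoly_deg. Qed.

Lemma LA_lift_class F
    (hF : F \in integral (ideal_exp (mseries_maxideal n k) t) (perp I)) :
  deg_lt d F -> LA_lift (LA_class hF) - F \in perp I.
Proof.
move=> Fd; rewrite PE; last first.
  by move=> m dm; rewrite mcoeffB LA_lift_deg // Fd // subr0.
rewrite submxE -scaleN1r addrC coefrow_linear scaleN1r rowpolyK mulmxDl mulNmx.
by rewrite LA_row_pi mulmxKpV ?submxMl //= addNr.
Qed.

End LinearLift.

Theorem theorem4p2 (k : closedFieldType) (n : nat) (I : ideal (mseries n k))
    (t : nat) :
  artinian (quotring I) ->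
  Gorenstein_colength I t ->
  exists MGC : set (proj (LA I t)),
    zariski_locally_closed MGC /\
    forall (F : {mpoly k[n]})
      (hF : F \in integral (ideal_exp (mseries_maxideal n k) t) (perp I))
      (F0 : LA_class hF != 0),
      MGC (proj_point F0) <-> minimal_Gorenstein_cover I F.
Proof.
move=> _ gcl; have [[E [EI [lA [lE [hA hE lEE]]]]] _] := gcl.
(* The cover [E] bounds the degrees in I^perp by [msize E], and integrating along the [t]-th power
   of the maximal ideal adds at most [t]. *)
pose d := (msize E + t)%N.
have Ie G : G \in perp I -> deg_lt (msize E) G.
  by move=> /EI /asboolP [f ->]; apply: contract_deg; apply: msize_out.
have deg_le (G : {mpoly k[n]}) : deg_lt (msize E) G -> deg_lt d G.
  by move=> Ge m dm; apply: Ge; apply: leq_trans dm; apply: leq_addr.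
have Id G : G \in perp I -> deg_lt d G by move/Ie/deg_le.
have [P PE] := perp_mx d I.
have Ed : deg_lt d E by apply: deg_le; apply: msize_out.
(* The cover [E] has catalecticant rank [lA + t] and its row space contains that of [P]; hence the
   subtraction in [r] below is not truncated. *)
have DleE : (\rank P <= lA + t)%N.
  rewrite -lEE (has_length_unique hE (length_annihilator Ed)).
  by apply: mxrankS; apply/(Gorenstein_coverP Id PE Ed).
pose M (v : LA I t) := cat_mx d (LA_lift P v).
have Mlin : linear M.
  by move=> a u v; rewrite /M (LA_lift_linear Id PE); apply: cat_mx_linear.
have MClin : linear (fun v => M v *m cokermx P).
  by move=> a u v; rewrite Mlin mulmxDl -scalemxAl.
(* The successor turns vanishing of all minors of size [r] into rank at most [lA + t - \rank P]. *)
pose r := (lA + t - \rank P).+1.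
pose Z (E : set (LA I t -> k)) : set (proj (LA I t)) :=
  fun X => forall f, E f -> forall v, proj_line X v -> f v = 0.
pose Z1 := Z (minors r (fun v => M v *m cokermx P)).
pose Z2 := Z (minors (lA + t) M).
exists (setI Z1 (setC Z2)); split.
  exists Z1, (setC Z2); split=> //.
    exists (minors r (fun v => M v *m cokermx P)); split=> // f.
    exact: minors_homogeneous.
  rewrite /zariski_open setCK.
  by exists (minors (lA + t) M); split=> // f; apply: minors_homogeneous.
move=> F hF F0; have Fd := integral_deg_lt Ie hF.
have FnI : F \notin perp I.
  apply: contra F0 => FI; apply/eqP.
  have -> : (0 : LA I t) = quotmod_pi _ 0 by rewrite /quotmod_pi raddf0.
  by apply/quotmod_piP; rewrite subr0; exact: FI.
set G := LA_lift P (LA_class hF).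
have Gd : deg_lt d G by apply: LA_lift_deg.
have GF : G - F \in perp I by apply: LA_lift_class.
have GnI : G \notin perp I.
  by apply: contra FnI => GI; have := rpredB GI GF; rewrite opprB addrC subrK.
rewrite (minimal_Gorenstein_coverP Id PE Fd hA gcl).
have -> : (setI Z1 (setC Z2)) (proj_point F0) <->
    (P <= cat_mx d G)%MS /\ \rank (cat_mx d G) = (lA + t)%N.
  rewrite /setI /setC /Z1 /Z2 /Z /= !minors_vanish // -/G ltnS.
  split=> [[h1 /negP]|[PG rG]].
    by rewrite -leqNgt => h2; have [] := rank_mul_coker h2 h1 DleE.
  by rewrite rank_mul_coker_sub // /M -/G rG ltnn.
(* Neither [F] nor [G] lies in I^perp, but their difference does, so [cover_perturb] applies in both
   directions. *)
split=> -[PX rX].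
  have FG : F - G \in perp I by rewrite -opprB rpredN.
  by have eqFG := cover_perturb Id PE Gd GnI FG PX; rewrite !eqFG.
by have eqFG := cover_perturb Id PE Fd FnI GF PX; rewrite !eqFG.
Qed.
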